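(* Consider a minimal SISO transfer function $\mathbf{G}(s)$. Suppose $p$ is a (possibly repeated) pole of $\mathbf{G}$, with order $n_p$. By partial fractions, $\mathbf{G}(s)$ can be (uniquely) decomposed additively as $$\mathbf{G}(s)=\sum_{j=1}^{n_p}\frac{\alpha_j}{(s-p)^j}+\frac{u(s)}{d(s)},$$ where $u(s)$ is coprime to $d(s)$, and $d(s)$ is coprime to $s-p$. Put $$m:=\min\{|p-p'|:\ p'\ne p,\ p' \text{ is a root of } (s-p)^j u(s)\}.$$ Then $m>0$, and for any $\epsilon>0$ such that $\epsilon<m$, there exists $\delta(\epsilon,\mathbf{G})>0$ such that if $\max_j|\alpha_j|<\delta(\epsilon,\mathbf{G})$, then $$\mathbf{G}(s)=\frac{\prod_{j=1}^{n_p}(s-p+\epsilon_j)\;n(s)}{(s-p)^{n_p}\,d(s)}$$ with $|\epsilon_j|<\epsilon$ for each $j$, for some polynomial $n(s)$ that is coprime to both $s-p$ and $d(s)$.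
   Context: A SISO transfer function is a scalar rational function of the complex variable $s$; minimal means that there is no common factor between its numerator and denominator. The $\alpha_j$ and $\epsilon_j$ are complex numbers, and $u(s)$, $d(s)$, $n(s)$ are polynomials in $s$ (complex coefficients allowed). The roots $p'\neq p$ of $(s-p)^j u(s)$ are exactly the roots $p'\ne p$ of $u(s)$, whatever $j$ is; the minimum $m$ may be infinite, if $u(s)$ is a constant or has a root only at $s=p$. The notation $\delta(\epsilon,\mathbf{G})$ indicates that the threshold may depend on $\epsilon$ and $\mathbf{G}$.
   Formalization: The claims about m and the factorization are stated for u(s) not identically zero: if u = 0 (e.g. G(s) = 1/s), every p' is a root, the minimum m does not exist, and the numerator has too low a degree for the factorization. *)

(* Defs.v *)
From HB Require Import structures.
From mathcomp Require Import all_boot all_order all_algebra.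
From mathcomp Require Import complex.
From mathcomp Require Import classical_sets reals constructive_ereal ereal.

Set Implicit Arguments.
Unset Strict Implicit.
Unset Printing Implicit Defensive.

Import Order.TTheory GRing.Theory Num.Theory.
Local Open Scope ring_scope.

Notation normc := ComplexField.Normc.normc.
Notation "x %:F" := (tofrac x) : ring_scope.

Record transfer_function (F : fieldType) := TransferFunction {
  tf_num : {poly F};
  tf_den : {poly F};
  tf_den_neq0 : tf_den != 0;
  tf_minimal : coprimep tf_num tf_den
}.

(* Equalities between transfer functions are stated in the field F(s), so that
   they do not depend on the representative num/den, which minimality fixes
   only up to a common nonzero scalar. *)
Definition tf_val (F : fieldType) (G : transfer_function F)
    : {fraction {poly F}} :=
  (tf_num G)%:F / (tf_den G)%:F.

(* By minimality, numerator and denominator share no root, so the order of the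
   pole p is the multiplicity of p as a root of the denominator. *)
Definition has_pole (F : fieldType) (G : transfer_function F) (p : F)
    (n : nat) : Prop :=
  (0 < n)%N /\ mup p (tf_den G) = n.

(* The coefficient written alpha_(j+1) on paper is alpha j, for j < n.
   Coprimality of d with s - p forces d != 0. *)
Definition partial_fractions (F : fieldType) (G : transfer_function F) (p : F)
    (n : nat) (alpha : 'I_n -> F) (u d : {poly F}) : Prop :=
  [/\ coprimep u d, coprimep d ('X - p%:P) &
      tf_val G = \sum_(j < n) (alpha j)%:P%:F / (('X - p%:P) ^+ j.+1)%:F
                 + u%:F / d%:F].

(* The infimum of the empty set is +oo; for u != 0 the set is finite, so the
   infimum is a minimum whenever the set is nonempty. *)
Definition root_distance (R : realType) (p : R[i]) (n : nat)
    (u : {poly R[i]}) : \bar R :=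
  ereal_inf [set (normc (p - p'))%:E | p' in
    [set p' | p' != p /\
              exists j : 'I_n, root (('X - p%:P) ^+ j.+1 * u) p']]%classic.

(* Main.v *)
Require Import Defs.
From HB Require Import structures.
From mathcomp Require Import all_boot all_order all_algebra.
From mathcomp Require Import complex.
From mathcomp Require Import classical_sets reals constructive_ereal ereal.
From mathcomp Require Import ring.

Set Implicit Arguments.
Unset Strict Implicit.
Unset Printing Implicit Defensive.

Import Order.TTheory GRing.Theory Num.Theory.
Local Open Scope ring_scope.

(** Let [X] be short for ['X - p%:P] and [n] for the order of the pole.  Over
    a common denominator, [sum_j alpha_j / X^j + u/d] is [N / (X^n * d)] with
    [N = A * d + X^n * u], where [A] has degree less than [n] and its
    coefficients in powers of [X] are the [alpha_j]
    ([principal_num], [partial_fracE]).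

    Existence and uniqueness of the decomposition are then statements about
    [A]: it is the residue modulo [X^n] that a Bezout relation between [d] and
    [X^n] produces ([partial_fractions_exist]), and two candidates differ by a
    multiple of [X^n] of degree less than [n] ([partial_fractions_unique]).

    For the factorisation, [N] tends to [X^n * u] when the [alpha_j] tend to
    [0], and this limit has [p] as a root of multiplicity at least [n].  By
    continuity of roots, [n] roots of [N], counted with multiplicity, are
    within [epsilon] of [p] as soon as the [alpha_j] are small enough
    ([prod_roots_near_pole]); they give the factors [X + eps_j], and the
    cofactor of their product is the polynomial sought.  It inherits from [N]
    its coprimality to [X] and to [d] ([partial_fractions_num_coprime]).

    The continuity of roots used here is [roots_near0].  Since [d] may have
    larger degree than [u], a perturbation may raise the degree and send some
    roots to infinity, so roots cannot be matched one to one; only those near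
    [0] are followed.  If every root of [N] had modulus at least [eta], every
    coefficient of [N] would be bounded by a multiple of the constant one
    ([coef_prod_XsubC_bound]), which is impossible when [N] is close to a
    nonzero polynomial that vanishes at [0].  So there is one small root
    ([exists_small_root]); dividing it out leaves a quotient close to the limit
    divided by ['X] ([coef_deflation_close]), and induction on the
    multiplicity finishes. *)

(** * Continuity of the roots near zero *)

(** Multiplying a polynomial by ['X - z] multiplies its constant coefficient by
    [|z|] in modulus, and the maximum of the weighted coefficients
    [|c_k| * eta ^+ k] by at most [eta + |z|], which is at most [2 * |z|]. *)

Lemma coef_prod_XsubC_bound (F : numDomainType) (eta : F) (s : seq F) :
    0 <= eta -> (forall z, z \in s -> eta <= `|z|) ->
  forall k, `|(\prod_(z <- s) ('X - z%:P))`_k| * eta ^+ k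
              <= 2 ^+ size s * `|(\prod_(z <- s) ('X - z%:P))`_0|.
Proof.
move=> eta0; elim: s => [|z s IHs] etas k.
  rewrite big_nil expr0 mul1r !coef1 normr1; case: k => [|k].
    by rewrite expr0 mulr1 normr1.
  by rewrite normr0 mul0r.
have etaz : eta <= `|z| by apply: etas; rewrite mem_head.
have {}IHs := IHs (fun y ys => etas y (mem_behead (s := z :: s) ys)).
rewrite big_cons /= mulrBl !coefB !coefXM !coefCM eqxx sub0r normrN normrM.
set q := \prod_(_ <- s) _ in IHs *.
have bound k' : `|z * q`_k'| * eta ^+ k' <= 2 ^+ size s * (`|z| * `|q`_0|).
  by rewrite normrM -mulrA [leRHS]mulrCA ler_wpM2l.
rewrite exprS -mulrA [leRHS]mulr_natl mulr2n.
apply: le_trans (_ : (`|if k == 0%N then 0 else q`_k.-1| * eta ^+ k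
                       + `|z * q`_k| * eta ^+ k) <= _).
  by rewrite -mulrDl ler_wpM2r ?exprn_ge0 // ler_normB.
apply: lerD => //; case: k => [|k] /=.
  by rewrite normr0 mul0r !mulr_ge0 ?exprn_ge0.
rewrite exprS mulrCA [leRHS]mulrCA; apply: ler_pM => //.
by rewrite mulr_ge0 ?exprn_ge0.
Qed.

(** The leading coefficient of [N0], seen as a coefficient of [N], stays away
    from [0], whereas the constant coefficient of [N] tends to [0];
    [coef_prod_XsubC_bound] forbids this when all roots of [N] have modulus at
    least [eta].  The size bound [M] makes its factor [2 ^+ size s] uniform in
    [N]. *)
Lemma exists_small_root (F : numClosedFieldType) (N0 : {poly F}) (M : nat)
    (eta : F) : 0 < eta -> N0 != 0 -> root N0 0 ->
  exists2 delta, 0 < delta & forall N : {poly F}, (size N <= M)%N ->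
    (forall k, `|N`_k - N0`_k| < delta) -> exists2 z, `|z| < eta & root N z.
Proof.
move=> eta0 N0n0 /rootP; rewrite horner_coef0 => N00.
pose k := (size N0).-1; pose c := `|lead_coef N0| * eta ^+ k.
have c0 : 0 < c by rewrite mulr_gt0 ?exprn_gt0 // normr_gt0 lead_coef_eq0.
have S0 : 0 < 2 ^+ M + eta ^+ k by rewrite addr_gt0 ?exprn_gt0.
(* This delta solves (|lead_coef N0| - delta) * eta ^+ k = 2 ^+ M * delta. *)
exists (c / (2 ^+ M + eta ^+ k)) => [|N sN closeN]; first exact: divr_gt0.
have [->|Nn0] := eqVneq N 0; first by exists 0; rewrite ?normr0 ?root0.
have [s defN] := closed_field_poly_normal N.
have [/hasP[z zs zeta]|/hasPn nos] := boolP (has (fun z => `|z| < eta) s).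
  by exists z; rewrite // defN rootZ ?lead_coef_eq0 // root_prod_XsubC.
have etas z : z \in s -> eta <= `|z|.
  by move=> /nos; rewrite real_ltNge ?realE ?(ltW eta0) ?normr_ge0 // negbK.
have := coef_prod_XsubC_bound (ltW eta0) etas k.
rewrite -(ler_pM2l (_ : 0 < `|lead_coef N|)) ?normr_gt0 ?lead_coef_eq0 //.
rewrite mulrA mulrCA -!normrM -!coefZ -defN => bound.
have ss : (size s <= M)%N.
  apply: leq_trans sN; rewrite [in leqRHS]defN size_scale ?lead_coef_eq0 //.
  by rewrite size_prod_XsubC.
set delta := _ / _ in closeN.
have ltk : `|lead_coef N0| - delta < `|N`_k|.
  rewrite ltrBlDr -ltrBlDl; apply: le_lt_trans (closeN k).
  by rewrite distrC; apply: lerB_dist.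
have lt0 : `|N`_0| < delta by have := closeN 0%N; rewrite N00 subr0.
have : (`|lead_coef N0| - delta) * eta ^+ k < 2 ^+ M * delta.
  apply: lt_le_trans (_ : `|N`_k| * eta ^+ k <= _).
    by rewrite ltr_pM2r ?exprn_gt0.
  apply: le_trans bound _; apply: ler_pM; rewrite ?exprn_ge0 ?(ltW lt0) //.
  by rewrite ler_weXn2l // ler1n.
by rewrite mulrBl ltrBlDr (mulrC (2 ^+ M)) -mulrDr /delta divfK ?gt_eqF // ltxx.
Qed.

Lemma coef_bound (F : numDomainType) (P : {poly F}) :
  exists2 B, 0 < B & forall k, `|P`_k| <= B.
Proof.
exists (1 + \sum_(i < size P) `|P`_i|) => [|k].
  by rewrite ltr_wpDr ?sumr_ge0.
have [lt|le] := ltnP k (size P); last first.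
  by rewrite nth_default // normr0 addr_ge0 ?sumr_ge0.
rewrite (bigD1 (Ordinal lt)) //= addrCA lerDl addr_ge0 ?sumr_ge0 //.
Qed.

(** Write [e k] for the [k]th coefficient of [q - N0].  Reading off coefficient
    [k.+1] gives [e k] as the error of the product plus
    [z * (N0`_k.+1 + e k.+1)], so the bound [d2] descends from [k.+1] to [k];
    it holds for large [k], where [e k] is [0]. *)
Lemma coef_deflation_close (F : numDomainType) (N0 q : {poly F})
    (z d1 d2 B : F) :
    0 <= d2 -> (forall k, `|N0`_k| <= B) -> d1 + `|z| * (B + d2) <= d2 ->
    (forall k, `|(q * ('X - z%:P))`_k - ('X * N0)`_k| <= d1) ->
  forall k, `|q`_k - N0`_k| <= d2.
Proof.
move=> d20 N0B d12 close.
pose m := maxn (size q) (size N0).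
have step k : `|q`_k.+1 - N0`_k.+1| <= d2 -> `|q`_k - N0`_k| <= d2.
  move=> IH; apply: le_trans d12.
  have -> : q`_k - N0`_k = ((q * ('X - z%:P))`_k.+1 - ('X * N0)`_k.+1)
                            + z * (N0`_k.+1 + (q`_k.+1 - N0`_k.+1)).
    by rewrite mulrBr coefB coefMX coefMC coefXM /=; ring.
  apply: le_trans (ler_normD _ _) _; apply: lerD; first exact: close.
  rewrite normrM ler_wpM2l //; apply: le_trans (ler_normD _ _) _.
  exact: lerD.
have high k : (m <= k)%N -> `|q`_k - N0`_k| <= d2.
  by rewrite geq_max => /andP[? ?]; rewrite !nth_default // subrr normr0.
move=> k; have := high (m + k)%N (leq_addr _ _).
by elim: m {high} => [|m IHm] //; rewrite addSn => /step.
Qed.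

Lemma exists_le_both (F : numFieldType) (a b : F) : 0 < a -> 0 < b ->
  exists c, [/\ 0 < c, c <= a & c <= b].
Proof.
move=> a0 b0; have ab0 : 0 < a + b by rewrite addr_gt0.
exists (a * b / (a + b)); split; first by rewrite divr_gt0 ?mulr_gt0.
  by rewrite ler_pdivrMr // ler_pM2l // lerDr ltW.
by rewrite ler_pdivrMr // mulrC ler_pM2l // lerDl ltW.
Qed.

(** The roots in [s] need not exhaust those of modulus below [eta]: ['X^K * u]
    may vanish at [0] with multiplicity greater than [K]. *)
Lemma roots_near0 (F : numClosedFieldType) (K M : nat) (u : {poly F})
    (eta : F) :
    0 < eta -> u != 0 ->
  exists2 delta, 0 < delta & forall N : {poly F}, (size N <= M)%N ->
    (forall k, `|N`_k - ('X^K * u)`_k| < delta) ->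
    exists s : seq F, [/\ size s = K, forall z, z \in s -> `|z| < eta &
      \prod_(z <- s) ('X - z%:P) %| N].
Proof.
move=> eta0 un0; elim: K M => [|K IHK] M.
  by exists 1 => // N _ _; exists [::]; split; rewrite // big_nil dvd1p.
have [d2 d20 {}IHK] := IHK M.
have [B B0 bndB] := coef_bound ('X^K * u).
pose h := d2 / 2; pose a := h / 2.
have h0 : 0 < h by rewrite divr_gt0.
have a0 : 0 < a by rewrite divr_gt0.
(* The bound on e lets the deflation of a root of modulus below e spend half
   of the tolerance h; the other half, a, is left for the error on N. *)
have [e [e0 le_e_eta le_e]] :=
  exists_le_both eta0 (divr_gt0 a0 (addr_gt0 B0 h0)).
have Xun0 : 'X^(K.+1) * u != 0.
  by rewrite mulf_neq0 // -size_poly_gt0 size_polyXn.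
have root0 : root ('X^(K.+1) * u) 0 by rewrite exprS -mulrA rootM rootX eqxx.
have [d1 d10 findroot] := exists_small_root M e0 Xun0 root0.
have [c [c0 le_c_d1 le_c_a]] := exists_le_both d10 a0.
exists c => // N sN closeN.
have [z ze /factor_theorem[q defN]] : exists2 z, `|z| < e & root N z.
  by apply: findroot => // k; apply: lt_le_trans le_c_d1.
have closeq k : `|q`_k - ('X^K * u)`_k| <= h.
  apply: (@coef_deflation_close _ _ _ z c) k => //; first exact: ltW.
    rewrite [leRHS](splitr h); apply: lerD => //.
    rewrite -ler_pdivlMr ?addr_gt0 //; exact: le_trans (ltW ze) le_e.
  by move=> k; rewrite -defN mulrA -exprS ltW.
have [|k|s [ss small dvds]] := IHK q; first 1 last.
- by apply: le_lt_trans (closeq k) _; rewrite /h ltr_pdivrMr // ltr_pMr // ltr1n.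
- exists (z :: s); split=> [|y|]; first by rewrite /= ss.
    rewrite inE => /predU1P[-> | /small //]; exact: lt_le_trans le_e_eta.
  by rewrite big_cons defN mulrC dvdp_mul2r ?polyXsubC_eq0.
apply: leq_trans sN; have [->|qn0] := eqVneq q 0; first by rewrite size_poly0.
by rewrite defN size_Mmonic ?monicXsubC // size_XsubC addn2.
Qed.

(** * Partial fractions over a common denominator *)

(** The [alpha j] are indexed from [0], whence the exponent [n - j.+1] where
    one writes [n - j] on paper. *)
Definition principal_num (F : fieldType) (p : F) (n : nat) (alpha : 'I_n -> F)
    : {poly F} :=
  \sum_(j < n) alpha j *: ('X - p%:P) ^+ (n - j.+1).

Lemma comp_principal_num (F : fieldType) (p : F) (n : nat) (alpha : 'I_n -> F) :
  principal_num p alpha \Po ('X + p%:P) = \sum_(j < n) alpha j *: 'X^(n - j.+1).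
Proof.
rewrite /principal_num linear_sum /=; apply: eq_bigr => j _.
by rewrite linearZ /= rmorphXn /= comp_polyB comp_polyX comp_polyC addrK.
Qed.

Lemma coef_comp_principal_num (F : fieldType) (p : F) (n : nat)
    (alpha : 'I_n -> F) (j : 'I_n) :
  (principal_num p alpha \Po ('X + p%:P))`_(n - j.+1) = alpha j.
Proof.
rewrite comp_principal_num coef_sum (bigD1 j) //= coefZ coefXn eqxx mulr1.
rewrite big1 ?addr0 // => i ij; rewrite coefZ coefXn.
case: eqP => [e|]; last by rewrite mulr0.
by case/eqP: ij; apply: rev_ord_inj; apply/val_inj; rewrite /= e.
Qed.

Lemma size_principal_num (F : fieldType) (p : F) (n : nat) (alpha : 'I_n -> F) :
  (size (principal_num p alpha) <= n)%N.
Proof.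
apply/leq_trans/(_ : \max_(j < n) (n - j.+1).+1 <= n)%N.
  apply: leq_trans (size_sum _ _ _) _; apply/bigmax_leqP => j _.
  apply: leq_trans (leq_bigmax j); apply: leq_trans (size_scale_leq _ _) _.
  by rewrite size_exp_XsubC.
by apply/bigmax_leqP => j _; rewrite subnSK // leq_subr.
Qed.

Lemma principal_num_surj (F : fieldType) (p : F) (n : nat) (A : {poly F}) :
  (size A <= n)%N -> exists alpha : 'I_n -> F, A = principal_num p alpha.
Proof.
move=> sA; exists (fun j => (A \Po ('X + p%:P))`_(n - j.+1)).
rewrite -[LHS](comp_polyXaddC_K _ p) -[RHS](comp_polyXaddC_K _ p).
congr (_ \Po _); rewrite comp_principal_num.
have sA' : (size (A \Po ('X + p%:P)) <= n)%N.
  by rewrite size_comp_poly2 ?size_XaddC.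
set A' := A \Po _ in sA' *; rewrite (reindex_inj rev_ord_inj) /=.
apply/polyP => k; rewrite -[in LHS](take_poly_id sA').
rewrite /take_poly poly_def !coef_sum; apply: eq_bigr => i _.
by rewrite subnSK // subKn // ltnW.
Qed.

Lemma principal_part_frac (F : fieldType) (p : F) (n : nat) (alpha : 'I_n -> F) :
  \sum_(j < n) (alpha j)%:P%:F / (('X - p%:P) ^+ j.+1)%:F
    = (principal_num p alpha)%:F / (('X - p%:P) ^+ n)%:F.
Proof.
rewrite /principal_num rmorph_sum /= mulr_suml; apply: eq_bigr => j _.
have X0 m : (('X - p%:P) ^+ m)%:F != 0.
  by rewrite tofrac_eq0 expf_neq0 // polyXsubC_eq0.
rewrite -mul_polyC rmorphM /= -mulrA; congr (_ * _).
apply: (mulfI (X0 j.+1)); rewrite mulfV // mulrA -rmorphM /= -exprD.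
by rewrite subnKC // mulfV.
Qed.

Lemma coprimep_XsubC_neq0 (F : fieldType) (d : {poly F}) (p : F) :
  coprimep d ('X - p%:P) -> d != 0.
Proof. by rewrite coprimep_XsubC; apply: contraNneq => ->; rewrite root0. Qed.

Lemma partial_fracE (F : fieldType) (p : F) (n : nat) (alpha : 'I_n -> F)
    (u d : {poly F}) : d != 0 ->
  \sum_(j < n) (alpha j)%:P%:F / (('X - p%:P) ^+ j.+1)%:F + u%:F / d%:F
    = (principal_num p alpha * d + ('X - p%:P) ^+ n * u)%:F
      / (('X - p%:P) ^+ n * d)%:F.
Proof.
move=> d0; rewrite principal_part_frac.
rewrite addf_div ?tofrac_eq0 ?expf_neq0 ?polyXsubC_eq0 //.
by rewrite -!rmorphM -rmorphD /= [u * _]mulrC.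
Qed.

Lemma tofrac_divP (F : fieldType) (a b c d : {poly F}) : b != 0 -> d != 0 ->
  a%:F / b%:F = c%:F / d%:F <-> a * d = c * b.
Proof.
move=> b0 d0; have E : (a%:F / b%:F == c%:F / d%:F) = (a * d == c * b).
  by rewrite eqr_div ?tofrac_eq0 // -!rmorphM /= tofrac_eq.
by split=> h; apply/eqP; [rewrite -E | rewrite E]; apply/eqP.
Qed.

(** A Bezout relation [a * d + b * X^n = 1] multiplied by the numerator of [G]
    gives [A] as the remainder of [num * a] by [X^n]; the quotient goes into
    [u].  Coprimality of [u] and [d] comes from minimality of [G]. *)
Lemma partial_fractions_exist (F : fieldType) (G : transfer_function F) (p : F)
    (n : nat) : has_pole G p n ->
  exists (alpha : 'I_n -> F) (u d : {poly F}), partial_fractions G p alpha u d.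
Proof.
case: G => num den den0 cop [_ /= mupn].
have /dvdpP[d defden] : ('X - p%:P) ^+ n %| den by rewrite -mup_geq // mupn.
have dn0 : d != 0 by move: den0; rewrite defden mulf_eq0 => /norP[].
(* One more factor X in d would make p a root of den of multiplicity n.+1. *)
have copd : coprimep d ('X - p%:P).
  rewrite coprimep_XsubC; apply/negP => /factor_theorem[d' defd].
  have : (n.+1 <= mup p den)%N.
    by rewrite mup_geq // defden defd -mulrA -exprS dvdp_mull.
  by rewrite mupn ltnn.
have /Bezout_eq1_coprimepP[[a b] /= bez] : coprimep d (('X - p%:P) ^+ n).
  by rewrite coprimep_expr.
pose A := (num * a) %% ('X - p%:P) ^+ n.
pose u := (num * a) %/ ('X - p%:P) ^+ n * d + num * b.
have defnum : num = A * d + ('X - p%:P) ^+ n * u.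
  rewrite -[LHS]mulr1 -bez mulrDr mulrA {1}(divp_eq (num * a) (('X - p%:P) ^+ n)).
  by rewrite -/A /u; ring.
have [|alpha defA] := @principal_num_surj F p n A.
  by rewrite -ltnS -(size_exp_XsubC n p) ltn_modp expf_neq0 // polyXsubC_eq0.
exists alpha, u, d; split=> //.
  have copnd : coprimep num d by apply: coprimep_dvdl cop; rewrite defden dvdp_mulr.
  rewrite coprimep_sym; move: copnd; rewrite coprimep_sym defnum.
  by rewrite coprimep_addl_mul coprimepMr => /andP[].
by rewrite partial_fracE // -defA -defnum /tf_val /= defden [d * _]mulrC.
Qed.

(** Clearing denominators, [X^n] divides [(A1 - A2) * (d1 * d2)], hence
    [A1 - A2], which has degree less than [n]. *)
Lemma partial_fractions_unique (F : fieldType) (G : transfer_function F) (p : F)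
    (n : nat) (alpha1 alpha2 : 'I_n -> F) (u1 d1 u2 d2 : {poly F}) :
    partial_fractions G p alpha1 u1 d1 -> partial_fractions G p alpha2 u2 d2 ->
  alpha1 =1 alpha2 /\ u1%:F / d1%:F = u2%:F / d2%:F :> {fraction {poly F}}.
Proof.
move=> [_ cop1 def1] [_ cop2 def2].
have [d1n0 d2n0] := (coprimep_XsubC_neq0 cop1, coprimep_XsubC_neq0 cop2).
have Xn0 : ('X - p%:P) ^+ n != 0 by rewrite expf_neq0 // polyXsubC_eq0.
have eqfr := etrans (esym def1) def2.
set A1 := principal_num p alpha1; set A2 := principal_num p alpha2.
have eqA : A1 = A2.
  move: eqfr; rewrite !partial_fracE // => /tofrac_divP.
  rewrite !mulf_neq0 // => /(_ isT isT); rewrite -/A1 -/A2 => eqN.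
  have : ('X - p%:P) ^+ n %| (A1 - A2) * (d1 * d2).
    apply/dvdpP; exists (u2 * d1 - u1 * d2); apply: (mulIf Xn0).
    apply/eqP; rewrite -subr_eq0; move/eqP: eqN; rewrite -subr_eq0 => /eqP <-.
    by apply/eqP; ring.
  rewrite Gauss_dvdpl; last by rewrite coprimep_sym coprimepMl !coprimep_expr.
  move=> dvd; apply/eqP; rewrite -subr_eq0; apply: contraTT dvd => nz.
  apply/negP => /(dvdp_leq nz); rewrite size_exp_XsubC leqNgt.
  rewrite ltnS (leq_trans (size_polyD _ _)) // size_polyN geq_max.
  by rewrite !size_principal_num.
split=> [j|]; first by rewrite -!(coef_comp_principal_num p) -/A1 eqA.
move: eqfr; rewrite !principal_part_frac -/A1 -/A2 eqA; exact: addrI.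
Qed.

(** Coprimality to [d] is that of [X^n * u], which is congruent to [N] modulo
    [d].  If [N] vanished at [p], then so would the numerator of [G], because
    the pole has order exactly [n]; this contradicts minimality. *)
Lemma partial_fractions_num_coprime (F : fieldType) (G : transfer_function F)
    (p : F) (n : nat) (alpha : 'I_n -> F) (u d : {poly F}) :
    has_pole G p n -> partial_fractions G p alpha u d ->
  coprimep (principal_num p alpha * d + ('X - p%:P) ^+ n * u)
           (('X - p%:P) * d).
Proof.
case: G => num den den0 cop [n0 /= mupn] [copu copd defG].
have d0 := coprimep_XsubC_neq0 copd.
have Xn0 : ('X - p%:P) ^+ n != 0 by rewrite expf_neq0 // polyXsubC_eq0.
move: defG; rewrite partial_fracE // /tf_val /= => /tofrac_divP.
rewrite mulf_neq0 // => /(_ den0 isT); set N := principal_num _ _ * _ + _ => eqN.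
have dvd_den : ('X - p%:P) ^+ n %| den by rewrite -mup_geq // mupn.
rewrite coprimepMr; apply/andP; split; last first.
  rewrite coprimep_sym /N coprimep_addl_mul coprimepMr.
  by rewrite coprimep_expr //= coprimep_sym.
have /dvdpP[e defden] := dvd_den.
have eqNe : num * d = N * e.
  by apply: (mulIf Xn0); rewrite -[RHS]mulrA -defden -eqN; ring.
rewrite coprimep_XsubC; apply/negP => /rootP Np.
have : root (num * d) p by rewrite eqNe rootM; apply/orP; left; apply/rootP.
rewrite rootM => /orP[nump|]; last by apply/negP; rewrite -coprimep_XsubC.
have /eqP := coprimep_root cop nump; apply; apply/rootP.
rewrite -dvdp_XsubCl; apply: dvdp_trans dvd_den.
by rewrite -(prednK n0) exprS dvdp_mulr.
Qed.

(** * Roots near the pole *)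

(** Translating [p] to [0], the summand containing the [alpha j] has
    coefficients at most [n * max |alpha j| * B] with [B] a bound on those of
    the translate of [d], so [roots_near0] applies. *)
Lemma prod_roots_near_pole (F : numClosedFieldType) (p : F) (n : nat)
    (u d : {poly F}) (e : F) : 0 < e -> u != 0 ->
  exists2 delta, 0 < delta & forall alpha : 'I_n -> F,
    (forall j, `|alpha j| < delta) ->
    exists2 eps : 'I_n -> F, forall j, `|eps j| < e &
      \prod_(j < n) ('X - p%:P + (eps j)%:P)
        %| principal_num p alpha * d + ('X - p%:P) ^+ n * u.
Proof.
move=> e0 un0; pose sh (P : {poly F}) := P \Po ('X + p%:P).
have un0' : sh u != 0 by rewrite comp_poly2_eq0 ?size_XaddC.
pose M := maxn (n + size d) (n + size u).
have [d1 d10 findroots] := roots_near0 n M.+1 e0 un0'.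
have [B B0 bndB] := coef_bound (sh d).
have C0 : 0 < n.+1%:R * B by rewrite mulr_gt0.
exists (d1 / (n.+1%:R * B)) => [|alpha small]; first exact: divr_gt0.
set N := principal_num _ _ * _ + _.
have shN : sh N = sh (principal_num p alpha) * sh d + 'X^n * sh u.
  rewrite /N /sh comp_polyD !comp_polyM rmorphXn /=.
  by rewrite comp_polyB comp_polyX comp_polyC addrK.
have [||s [ss near dvds]] := findroots (sh N).
- rewrite size_comp_poly2 ?size_XaddC //; apply: leq_trans (size_polyD _ _) _.
  rewrite geq_max; apply/andP; split; apply: leq_trans (size_polyMleq _ _) _.
    rewrite (leq_trans (leq_pred _)) // leqW // leq_max leq_add2r.
    by rewrite size_principal_num.
  by rewrite size_exp_XsubC addSn /= leqW // leq_max leqnn orbT.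
- move=> k; rewrite shN coefD addrK /sh comp_principal_num mulr_suml coef_sum.
  apply: le_lt_trans (ler_norm_sum _ _ _) _.
  apply: le_lt_trans (_ : _ <= \sum_(j < n) d1 / (n.+1%:R * B) * B) _.
    apply: ler_sum => j _.
    rewrite -scalerAl coefZ normrM ler_pM ?(ltW (small j)) //.
    by rewrite coefXnM; case: ifP => // _; rewrite normr0 ltW.
  rewrite sumr_const card_ord invfM mulrA divfK ?gt_eqF // -[_ *+ n]mulr_natr mulrAC.
  by rewrite ltr_pdivrMr // ltr_pM2l // ltr_nat.
exists (fun j => - s`_j) => [j|].
  by rewrite normrN near // mem_nth ?ss.
rewrite -(comp_polyXaddC_K N p) -/(sh N).
have -> : \prod_(j < n) ('X - p%:P + (- s`_j)%:P)
          = (\prod_(z <- s) ('X - z%:P)) \Po ('X - p%:P).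
  rewrite rmorph_prod /= (big_nth 0) ss big_mkord; apply: eq_bigr => j _.
  by rewrite comp_polyB comp_polyX comp_polyC polyCN.
exact: dvdp_comp_poly.
Qed.

(** * The distance to the other roots *)

Lemma gap_from_roots (F : numClosedFieldType) (u : {poly F}) (p : F) : u != 0 ->
  exists2 r, 0 < r & forall z, root u z -> z != p -> r <= `|p - z|.
Proof.
move=> un0; have [s defu] := closed_field_poly_normal u.
suff [r r0 sep] : exists2 r : F, 0 < r &
    forall z, z \in s -> z != p -> r <= `|p - z|.
  exists r => // z; rewrite defu rootZ ?lead_coef_eq0 // root_prod_XsubC.
  exact: sep.
elim: s {defu} => [|y s [r r0 sep]]; first by exists 1.
have [->|yp] := eqVneq y p.
  exists r => // z; rewrite inE => /predU1P[->|/sep //]; by rewrite eqxx.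
have py0 : 0 < `|p - y| by rewrite normr_gt0 subr_eq0 eq_sym.
have [c [c0 cr cy]] := exists_le_both r0 py0.
exists c => // z; rewrite inE => /predU1P[-> //|/sep zs zp].
exact: le_trans cr (zs zp).
Qed.

Lemma posc_real (R : rcfType) (x : R[i]) :
  0 < x -> exists2 r : R, 0 < r & x = r%:C%C.
Proof.
rewrite ltcE /= => /andP[/eqP im re]; exists (complex.Re x) => //.
by rewrite [LHS]complexE im mulr0 addr0.
Qed.

Lemma root_distance_gt0 (R : realType) (p : R[i]) (n : nat) (u : {poly R[i]}) :
  u != 0 -> (0%:E < root_distance p n u)%E.
Proof.
move=> un0; have [r0 /posc_real[r r_gt0 ->] sep] := gap_from_roots p un0.
apply: lt_le_trans (_ : r%:E <= _)%E; first by rewrite lte_fin.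
apply: le_ereal_inf_tmp => _ [z [zp [j rootz]] <-]; move: rootz.
rewrite rootM => /orP[|uz]; last by rewrite lee_fin -lecR; exact: sep.
move=> /rootP/eqP; rewrite horner_exp hornerXsubC expf_eq0 subr_eq0.
by rewrite (negPf zp) andbF.
Qed.

Theorem lemma6 (R : realType) (G : transfer_function R[i]) (p : R[i])
    (np : nat) (hp : has_pole G p np) :
  (exists (alpha : 'I_np -> R[i]) (u d : {poly R[i]}),
     partial_fractions G p alpha u d) /\
  (forall (alpha1 alpha2 : 'I_np -> R[i]) (u1 d1 u2 d2 : {poly R[i]}),
     partial_fractions G p alpha1 u1 d1 ->
     partial_fractions G p alpha2 u2 d2 ->
     alpha1 =1 alpha2 /\
     u1%:F / d1%:F = u2%:F / d2%:F :> {fraction {poly R[i]}}) /\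
  (forall (alpha0 : 'I_np -> R[i]) (u d : {poly R[i]}),
     partial_fractions G p alpha0 u d -> u != 0 ->
     (0%:E < root_distance p np u)%E /\
     (forall epsilon : R, 0 < epsilon ->
       (epsilon%:E < root_distance p np u)%E ->
       (* The threshold delta may depend on u, d, p and np, but must not be
          chosen after the residues: it serves every transfer function that
          differs from G only in them, G itself (alpha = alpha0) included. *)
       exists2 delta : R, 0 < delta &
         forall (H : transfer_function R[i]) (alpha : 'I_np -> R[i]),
           has_pole H p np -> partial_fractions H p alpha u d ->
           \big[Num.max/0]_(j < np) normc (alpha j) < delta ->
           exists (eps : 'I_np -> R[i]) (n : {poly R[i]}),
             [/\ forall j : 'I_np, normc (eps j) < epsilon,
                 coprimep n ('X - p%:P),
                 coprimep n d &
                 tf_val H =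
                   ((\prod_(j < np) ('X - p%:P + (eps j)%:P)) * n)%:F
                   / (('X - p%:P) ^+ np * d)%:F])).
Proof.
split; first exact: partial_fractions_exist.
split; first by move=> *; apply: partial_fractions_unique; eassumption.
move=> alpha0 u d _ un0; split; first exact: root_distance_gt0.
move=> epsilon e0 _.
have [|_ /posc_real[delta delta0 ->] factor] :=
    prod_roots_near_pole p np d (_ : 0 < epsilon%:C%C) un0.
  by rewrite ltcR.
exists delta => // H alpha hH pfH small.
have [j|eps epsP /dvdpP[n defN]] := factor alpha.
  by rewrite ltcR; apply: le_lt_trans small; apply: le_bigmax.
have := partial_fractions_num_coprime hH pfH.
rewrite defN coprimepMl coprimepMr => /andP[/andP[copnX copnd] _].
exists eps, n; split=> // [j|]; first by rewrite -ltcR epsP.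
have [_ copd ->] := pfH.
by rewrite partial_fracE ?(coprimep_XsubC_neq0 copd) // defN [n * _]mulrC.
Qed.
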